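(* There exists an outerplanar graph whose track number is exactly $5$ (i.e. it has no $4$-track layout).
   Context: A $t$-track assignment of a graph $G$ is a partition of $V(G)$ into $t$ sets $V_1,\dots,V_t$ (tracks), each an independent set of $G$, together with a total order $<_i$ on each $V_i$. An X-crossing consists of two edges $(u,v)$ and $(x,y)$ with $u,x\in V_i$, $v,y\in V_j$ ($i\neq j$), $u<_i x$ and $y<_j v$. A $t$-track layout is a $t$-track assignment with no X-crossing; the track number $\mathrm{tn}(G)$ is the minimum $t$ for which $G$ has a $t$-track layout. *)

(* Defs.v *)
From mathcomp Require Import all_boot.
Set Implicit Arguments. Unset Strict Implicit. Unset Printing Implicit Defensive.

Definition simple_graph (T : finType) (e : rel T) : Prop :=
  symmetric e /\ irreflexive e.

(* Outerplanar: the vertices can be placed on a circle (equivalently, in a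
   linear order p) so that no two edges cross as chords, i.e. there are no
   edges ab, cd with p a < p c < p b < p d. *)
Definition outerplanar (T : finType) (e : rel T) : Prop :=
  exists p : T -> nat, injective p /\
    forall a b c d : T, e a b -> e c d ->
      ~ (p a < p c /\ p c < p b /\ p b < p d).

Definition track_assignment (T : finType) (e : rel T) (t : nat)
    (track : T -> 'I_t) (ord : rel T) : Prop :=
  (forall u v : T, e u v -> track u != track v) /\
  (forall u : T, ~~ ord u u) /\
  (forall u v w : T, track u = track v -> track v = track w ->
       ord u v -> ord v w -> ord u w) /\
  (forall u v : T, track u = track v -> u != v -> ord u v || ord v u).

Definition X_crossing (T : finType) (e : rel T) (t : nat)
    (track : T -> 'I_t) (ord : rel T) (u v x y : T) : Prop :=
  e u v /\ e x y /\ track u = track x /\ track v = track y /\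
  track u != track v /\ ord u x /\ ord y v.

Definition track_layout (T : finType) (e : rel T) (t : nat)
    (track : T -> 'I_t) (ord : rel T) : Prop :=
  track_assignment e track ord /\
  forall u v x y : T, ~ X_crossing e track ord u v x y.

Definition has_track_layout (T : finType) (e : rel T) (t : nat) : Prop :=
  exists (track : T -> 'I_t) (ord : rel T), track_layout e track ord.

Definition track_number_is (T : finType) (e : rel T) (k : nat) : Prop :=
  has_track_layout e k /\ forall t : nat, t < k -> ~ has_track_layout e t.

(* Main.v *)
Require Import Defs.
From mathcomp Require Import all_boot.
Set Implicit Arguments.
Unset Strict Implicit.
Unset Printing Implicit Defensive.

(** Glue to each side [4a, 4a+4] of the triangle [0, 4, 8] (indices modulo 12)
    the triangle with apex [4a+1], to [4a+1, 4a+4] the triangle with apex [4a+3],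
    and to [4a+1, 4a+3] the triangle with apex [4a+2].  The cyclic order of the
    indices is an outerplanar embedding.  Given a layout on at most four tracks,
    adding the vertices one at a time inserts each of them at some position of
    a track already in use or on a fresh track, never creating an X-crossing;
    as tracks are interchangeable, a fresh track may be taken to be the next
    one.  An exhaustive search of such insertions gets stuck after fewer than
    eight thousand attempts.  On the other hand, a layout on five tracks exists. *)

Section Search.

Variables (T : finType) (e : rel T).

Definition joined (A B : seq T) : bool := has (fun x => has (e x) B) A.

(** [A] and [B] are the stretches of a track before and after the new vertex [w]. An edge from [w]
    to [v] in [s] is crossed by edges from [A] to beyond [v] and from [B] to before [v]. *)
Definition clash (w : T) (A B s : seq T) : bool :=
  has (fun m => if e w (nth w s m)
                then joined A (drop m.+1 s) || joined B (take m s) else false)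
      (iota 0 (size s)).

Definition blocked (w : T) (L : seq (seq T)) (i k : nat) : bool :=
  let s := nth [::] L i in
  has (e w) s || has (clash w (take k s) (drop k s)) L.

(* A fresh track is [i = size L]: [nth] and [set_nth] treat it as empty. *)
Definition insert_at (w : T) (L : seq (seq T)) (i k : nat) : seq (seq T) :=
  let s := nth [::] L i in set_nth [::] L i (take k s ++ w :: drop k s).

(* The conditional, unlike [||], prunes the search under call by value. *)
Fixpoint refuted (t : nat) (ws : seq T) (L : seq (seq T)) : bool :=
  if ws is w :: ws' then
    (w \notin flatten L) &&
    all (fun i =>
      all (fun k => if blocked w L i k then true
                    else refuted t ws' (insert_at w L i k))
          (iota 0 (size (nth [::] L i)).+1))
      (iota 0 (minn t (size L).+1))
  else false.

Variables (t : nat) (track : T -> 'I_t) (ord : rel T).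
Hypothesis lay : track_layout e track ord.

(** [cs] names the actual track behind each list of [L]. The default [c] is quantified because
    ['I_t] may be empty. *)
Definition realized (L : seq (seq T)) : Prop :=
  exists2 cs : seq 'I_t, uniq cs /\ size cs = size L &
    forall i c, i < size L ->
      {in nth [::] L i, forall x, track x = nth c cs i} /\
      sorted ord (nth [::] L i).

Lemma sorted_insert (c : 'I_t) (w : T) (s : seq T) :
  {in s, forall x, track x = c} -> track w = c -> w \notin s ->
  sorted ord s ->
  exists2 k, k <= size s & sorted ord (take k s ++ w :: drop k s).
Proof.
case: lay => -[_ [_ [_ tot]]] _.
elim: s => [|x s IHs] sc wc; first by exists 0.
rewrite inE negb_or => /andP[wx ws] xs.
have xc : track x = c by apply: sc; rewrite mem_head.
have /orP[lt_wx|lt_xw] : ord w x || ord x w by apply: tot; rewrite ?wc.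
  by exists 0 => //=; rewrite lt_wx.
have [y sy|k ks sk] := IHs _ wc ws (path_sorted xs).
  by apply: sc; rewrite inE sy orbT.
exists k.+1 => //=.
case: k s xs {IHs sc ws} ks sk => [|k] [|y s] //=; rewrite ?take0 ?drop0 /=.
- by rewrite lt_xw.
- by move=> _ _ ->; rewrite lt_xw.
- by case/andP=> ->.
Qed.

(** Transitivity of [ord] is assumed only within a track; on the common track [c] it turns
    sortedness into pairwise comparison. *)
Lemma sorted_ord_lt (c : 'I_t) (s1 s2 : seq T) (x y : T) :
  {in s1 ++ s2, forall z, track z = c} -> sorted ord (s1 ++ s2) ->
  x \in s1 -> y \in s2 -> ord x y.
Proof.
case: lay => -[_ [_ [tr _]]] _ sc.
rewrite (sorted_pairwise_in (P := mem (s1 ++ s2))); last 2 first.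
- by move=> v u w vs us ws; apply: tr; rewrite !sc.
- exact/allP.
by rewrite pairwise_cat => /and3P[/allrelP H _ _]; apply: H.
Qed.

Lemma not_clash (c d : 'I_t) (w : T) (A B s : seq T) :
  {in A ++ w :: B, forall x, track x = c} -> sorted ord (A ++ w :: B) ->
  {in s, forall x, track x = d} -> sorted ord s -> c != d ->
  ~~ clash w A B s.
Proof.
case: lay => _ noX Ac Asort sd ssort neq_cd.
apply/hasPn => m; rewrite mem_iota /= add0n => lt_m.
apply/negP; case: ifP => // ewv.
have vs : nth w s m \in s by rewrite mem_nth.
set v := nth w s m in ewv vs *.
have sE : s = take m s ++ v :: drop m.+1 s by rewrite -drop_nth // cat_take_drop.
have wA : w \in A ++ w :: B by rewrite mem_cat mem_head orbT.
case/orP => /hasP[x xA /hasP[y ys exy]].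
- have xc : x \in A ++ w :: B by rewrite mem_cat xA.
  have ys' : y \in s by rewrite (mem_drop ys).
  (* Here [x] precedes [w] while [v] precedes [y]; the other case is the mirror image. *)
  apply: (noX x y w v); do ![split => //]; rewrite ?(Ac _ xc) ?(Ac _ wA) ?sd //.
  + by apply: (sorted_ord_lt Ac Asort); rewrite ?mem_head.
  + move: sd ssort; rewrite sE -cat_rcons => sd ssort.
    by apply: (sorted_ord_lt sd ssort); rewrite ?mem_rcons ?mem_head.
- have xc : x \in A ++ w :: B by rewrite mem_cat inE xA !orbT.
  have ys' : y \in s by rewrite (mem_take ys).
  apply: (noX w v x y); do ![split => //]; rewrite ?(Ac _ xc) ?(Ac _ wA) ?sd //.
  + move: Ac Asort; rewrite -cat_rcons => Ac Asort.
    by apply: (sorted_ord_lt Ac Asort); rewrite ?mem_rcons ?mem_head.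
  + move: sd ssort; rewrite sE => sd ssort.
    by apply: (sorted_ord_lt sd ssort); rewrite ?mem_head.
Qed.

(** The place that the layout itself gives to [w] among the vertices of [L] is an insertion that the
    search tries and does not block. *)
Lemma realized_insert (w : T) (L : seq (seq T)) :
  realized L -> w \notin flatten L ->
  exists i k, [/\ i < minn t (size L).+1, k <= size (nth [::] L i),
    ~~ blocked w L i k & realized (insert_at w L i k)].
Proof.
case: (lay) => -[indep _] _ [cs [Ucs sz_cs] HL] wL.
have wN i : i < size L -> w \notin nth [::] L i.
  move=> iL; apply: contra wL => wi; apply/flattenP.
  by exists (nth [::] L i); rewrite ?mem_nth.
(* If the track of [w] is not yet in use, [index] returns [size cs], which is the position of the
   fresh track. *)
pose i := index (track w) cs.
have le_i : i <= size L by rewrite -sz_cs index_size.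
pose cs' := if i < size L then cs else rcons cs (track w).
have cs_i c : nth c cs' i = track w.
  rewrite /cs'; case: ltnP => [lt_i|ge_i].
    by rewrite nth_index // -index_mem -/i sz_cs.
  by rewrite nth_rcons sz_cs ltnNge ge_i eqn_leq le_i ge_i.
have Ucs' : uniq cs'.
  rewrite /cs'; case: ltnP => // ge_i.
  by rewrite rcons_uniq Ucs -index_mem -/i -leqNgt sz_cs ge_i.
have sz_cs' : size cs' = maxn i.+1 (size L).
  rewrite /cs'; case: ltnP => [lt_i|ge_i]; first by rewrite sz_cs (maxn_idPr lt_i).
  have -> : i = size L by apply/eqP; rewrite eqn_leq le_i.
  by rewrite size_rcons sz_cs (maxn_idPl (leqnSn _)).
have cs_j c j : j < size L -> nth c cs' j = nth c cs j.
  by move=> lt_j; rewrite /cs'; case: ifP; rewrite // nth_rcons sz_cs lt_j.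
(* The entries of [cs'] are distinct elements of ['I_t], so there are at most [t] of them. *)
have lt_it : i < t.
  have : size cs' <= t by rewrite -(card_uniqP Ucs') -[leqRHS]card_ord max_card.
  by rewrite sz_cs'; apply: leq_trans; rewrite leq_maxl.
have [ti si] : {in nth [::] L i, forall x, track x = track w} /\
               sorted ord (nth [::] L i).
  have [lt_i|ge_i] := ltnP i (size L); last by rewrite nth_default.
  have [ti si] := HL i (track w) lt_i; split=> // x /ti ->.
  by rewrite -cs_j ?cs_i.
have wi : w \notin nth [::] L i.
  have [|ge_i] := ltnP i (size L); first exact: wN.
  by rewrite nth_default.
have [k le_k sk] := sorted_insert ti (erefl _) wi si.
set s := nth [::] L i in ti si wi le_k sk.
have tk : {in take k s ++ w :: drop k s, forall x, track x = track w}.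
  move=> x; rewrite mem_cat inE orbCA => /orP[/eqP->//|xs].
  by apply: ti; rewrite -(cat_take_drop k s) mem_cat.
exists i, k; split=> //.
- by rewrite leq_min lt_it ltnS.
- have Ni : ~~ has (e w) s.
    by apply/hasPn => x xs; apply/negP => /indep; rewrite (ti _ xs) eqxx.
  rewrite /blocked -/s (negPf Ni) /=; apply/hasPn => r /(nthP [::])[j lt_j <-].
  (* On its own track [w] has no neighbour, so nothing can clash there. *)
  have [->|neq_ji] := eqVneq j i.
    apply/hasPn => m; rewrite mem_iota add0n => /= lt_m.
    by rewrite (negPf (hasPn Ni _ (mem_nth w lt_m))).
  have [tj sj] := HL j (track w) lt_j.
  apply: (not_clash tk sk tj sj).
  rewrite -cs_j // -[X in X != _](cs_i (track w)) nth_uniq // ?sz_cs' ?leq_max.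
  + by rewrite eq_sym.
  + by rewrite leqnn.
  + by rewrite lt_j orbT.
- have szI : size (insert_at w L i k) = maxn i.+1 (size L) by rewrite size_set_nth.
  exists cs'; first by rewrite szI.
  rewrite szI => j c; rewrite nth_set_nth /= -/s => lt_j.
  case: eqVneq => [->|neq_ji]; first by split=> // x /tk ->; rewrite cs_i.
  have lt_jL : j < size L.
    move: lt_j; rewrite leq_max => /orP[|//]; rewrite ltnS leq_eqVlt (negPf neq_ji).
    by move=> /= /leq_trans; apply.
  have [tj sj] := HL j c lt_jL; split=> // x /tj ->.
  by rewrite cs_j.
Qed.

(** One of the insertions tried is unblocked and again realized, so the refutation of that branch
    contradicts the induction hypothesis. *)
Lemma refuted_not_realized (ws : seq T) (L : seq (seq T)) :
  refuted t ws L -> ~ realized L.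
Proof.
elim: ws L => // w ws IHws L /andP[wL /allP H] rL.
have [i [k [lt_i le_k nb /IHws]]] := realized_insert rL wL; apply.
have /H/allP/(_ k) : i \in iota 0 (minn t (size L).+1) by rewrite mem_iota.
by rewrite mem_iota add0n ltnS (negPf nb) => /(_ le_k).
Qed.

End Search.

Lemma refuted_no_track_layout (T : finType) (e : rel T) (t : nat) (ws : seq T) :
  refuted e t ws [::] -> ~ has_track_layout e t.
Proof.
by move=> H [track [ord lay]]; apply: (refuted_not_realized lay H); exists [::].
Qed.

(** [d] is the cyclic distance from [i] to [j]; adding 12 keeps the subtraction from truncating.
    Distance 1 gives the outer cycle, the other cases the chords. *)
Definition adj12 (i j : nat) : bool :=
  let arc i j :=
    let d := (j + 12 - i) %% 12 in
    [|| d == 1, (i %% 4 == 0) && (d == 4) |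
        (i %% 4 == 1) && ((d == 2) || (d == 3))] in
  arc i j || arc j i.

(* Unlike [inord], this reduces to a constructor. *)
Definition vertex12 (i : nat) : 'I_12 := Ordinal (ltn_pmod i (isT : 0 < 12)).

Definition tracks5 : seq (seq nat) :=
  [:: [:: 1; 8; 11]; [:: 3; 0; 10]; [:: 2; 4; 7; 9]; [:: 5]; [:: 6]].

Definition track5 (i : nat) : nat := find (fun s => i \in s) tracks5.

(** Concatenating the tracks yields one linear order that restricts to the listed order on each of
    them. *)
Definition ord5 (i j : nat) : bool :=
  index i (flatten tracks5) < index j (flatten tracks5).

(** Reduces quantification over ordinals to a boolean test on numbers, fit for [vm_compute]. *)
Lemma forall_iota (n : nat) (P : pred nat) :
  all P (iota 0 n) -> forall i : 'I_n, P i.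
Proof. by move=> /allP H i; apply: H; rewrite mem_iota /=. Qed.

Lemma forall_iota2 (n : nat) (P : rel nat) :
  all (fun i => all (P i) (iota 0 n)) (iota 0 n) -> forall i j : 'I_n, P i j.
Proof. by move=> H i; apply: forall_iota; apply: (forall_iota H). Qed.

Lemma adj12_sym : symmetric adj12.
Proof. by move=> i j; rewrite /adj12 orbC. Qed.

Lemma outerplanar_adj12 : outerplanar (fun i j : 'I_12 => adj12 i j).
Proof.
exists val; split; first exact: val_inj.
(* Four quantifiers are nested as two pairs, one for each use of [forall_iota2]. *)
pose P a b := adj12 a b ==>
  all (fun c => all (fun d => adj12 c d ==> ~~ [&& a < c, c < b & b < d])
                    (iota 0 12)) (iota 0 12).
have HP : forall a b : 'I_12, P a b by apply: (forall_iota2 (P := P)); vm_compute.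
move=> a b c d eab ecd [ac [cb bd]].
have /implyP/(_ eab)/forall_iota2/(_ c d) := HP a b.
by rewrite ecd ac cb bd.
Qed.

Lemma track5_lt : forall i : 'I_12, track5 i < 5.
Proof. by apply: (forall_iota (P := fun i => track5 i < 5)); vm_compute. Qed.

Lemma track_layout5_adj12 :
  has_track_layout (fun i j : 'I_12 => adj12 i j) 5.
Proof.
exists (fun i => Ordinal (track5_lt i)), (fun i j : 'I_12 => ord5 i j); split.
  split; [|split; [|split]].
  - move=> u v; apply/implyP; move: u v.
    by apply: (forall_iota2
      (P := fun u v => adj12 u v ==> (track5 u != track5 v))); vm_compute.
  - by move=> u; rewrite /ord5 ltnn.
  - by move=> u v w _ _; apply: ltn_trans.
  - move=> u v _; rewrite -val_eqE /=; apply/implyP; move: u v.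
    by apply: (forall_iota2
      (P := fun u v => (u != v) ==> (ord5 u v || ord5 v u))); vm_compute.
pose P u v := adj12 u v ==>
  all (fun x => all (fun y => adj12 x y ==>
     ~~ [&& track5 u == track5 x, track5 v == track5 y, ord5 u x & ord5 y v])
                    (iota 0 12)) (iota 0 12).
have HP : forall u v : 'I_12, P u v by apply: (forall_iota2 (P := P)); vm_compute.
move=> u v x y [euv [exy [/(congr1 val) /= tux [/(congr1 val) /= tvy [_ [ux yv]]]]]].
have /implyP/(_ euv)/forall_iota2/(_ x y) := HP u v.
by rewrite exy tux tvy !eqxx ux yv.
Qed.

Lemma no_track_layout_adj12 (t : nat) :
  t < 5 -> ~ has_track_layout (fun i j : 'I_12 => adj12 i j) t.
Proof.
(* After [0, 4, 8], each vertex completes a triangle with two vertices already placed, so two edges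
   constrain its insertion. *)
move=> lt_t5; apply: (@refuted_no_track_layout _ _ _
  (map vertex12 [:: 0; 4; 8; 1; 3; 2; 5; 7; 6; 9; 11; 10])).
by case: t lt_t5 => [|[|[|[|[|//]]]]] _; vm_compute.
Qed.

Theorem theorem9 :
  exists (n : nat) (e : rel 'I_n),
    simple_graph e /\ outerplanar e /\ track_number_is e 5.
Proof.
exists 12, (fun i j => adj12 i j); split; last first.
  split; first exact: outerplanar_adj12.
  by split; [exact: track_layout5_adj12 | exact: no_track_layout_adj12].
split; first by move=> i j; apply: adj12_sym.
move=> i; apply/negbTE; move: i.
by apply: (forall_iota (P := fun i => ~~ adj12 i i)); vm_compute.
Qed.
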